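(* Let $S$ be a finite poset with an initial $k$-chain decomposition $\mathcal{C}=\{C_1,\dots,C_k\}$, and let legal merges be defined by the coloring of $S$ that $\mathcal{C}$ induces. Every chain decomposition of $S$ can be transformed into a minimal decomposition after finitely many legal merges, where the final number of chains equals the width of $S$.
   Context: The width of a finite poset $S$ is the maximum size of an antichain in $S$. A chain decomposition of $S$ is a partition of $S$ into chains (totally ordered subsets), taken to be nonempty; it is minimal if no chain decomposition of $S$ has fewer chains. Coloring: given the initial $k$-chain decomposition $\mathcal{C}=\{C_1,\dots,C_k\}$ of $S$, color $i$ is assigned to every element $x\in C_i$. Thus two elements share a color if and only if they belong to the same chain of $\mathcal{C}$, and any two elements of the same color are comparable. Legal merge: let $\mathcal{C}'$ be an arbitrary chain decomposition of $S$. The monochromatic bottom segment of a chain $A$ in $\mathcal{C}'$ is the largest initial segment of $A$ (starting from its minimal element) all of whose elements have the color of the minimal element of $A$. If two chains in $\mathcal{C}'$ have minimal elements of the same color, a legal merge merges their monochromatic bottom segments: the segment whose own maximal element is smaller is removed from its chain and merged into the chain containing the segment with the larger maximal element. Since all elements of one color are pairwise comparable, the merged set is again a chain. If the chain that loses its bottom segment becomes empty, it is discarded.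
   Formalization: The initial chain decomposition C is additionally assumed to be minimal; for any non-minimal C the claim fails, since C itself admits no legal merge (e.g. S = {a<b} with C = {{a},{b}}). *)

(* Defs.v *)
From HB Require Import structures.
From mathcomp Require Import all_boot all_order.

Set Implicit Arguments.
Unset Strict Implicit.
Unset Printing Implicit Defensive.

Import Order.TTheory.

Local Open Scope order_scope.

Section ChainDecompositions.

Context {d : Order.disp_t} {T : finPOrderType d}.
Implicit Types (x y a b p q : T) (A B I : {set T}) (C D E : {set {set T}}).

Definition is_chain A : bool :=
  [forall x in A, forall y in A, x >=< y].

Definition is_antichain A : bool :=
  [forall x in A, forall y in A, (x != y) ==> (x >< y)].

(* [partition D [set: T]] already forces the members of [D] to be nonempty. *)
Definition is_chain_decomposition D : bool :=
  partition D [set: T] && [forall A in D, is_chain A].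

Definition is_minimal_decomposition D : Prop :=
  is_chain_decomposition D /\
  forall E, is_chain_decomposition E -> (#|D| <= #|E|)%N.

Definition is_minimum A a : bool := (a \in A) && [forall x in A, a <= x].

Definition is_maximum A p : bool := (p \in A) && [forall x in A, x <= p].

(* The chains of [C] themselves serve as colors: the color of [x] is the
   chain of [C] that contains [x]. *)
Definition color C x : {set T} := pblock C x.

Definition is_initial_segment A I : bool :=
  (I \subset A) && [forall x in I, forall y in A, (y <= x) ==> (y \in I)].

(* The bottom segment of a chain [A] with minimum [a]. The initial segments of
   [A] that have the color of [a] throughout are closed under union, so their
   union is the largest of them. *)
Definition bottom_segment C A a : {set T} :=
  \bigcup_(I : {set T} | is_initial_segment A I &&
                         [forall x in I, color C x == color C a]) I.

(* Move the part [M] of the chain [A] of [D] to the chain [B] of [D]; removing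
   [set0] discards what is left of [A] when that is empty. *)
Definition move_segment D A B M : {set {set T}} :=
  ((D :\: [set A; B]) :|: [set A :\: M; B :|: M]) :\ set0.

(* [legal_merge C D E]: in the coloring induced by [C], one legal merge turns
   [D] into [E]. The chain losing its bottom segment is [A]; [a], [b] are the
   minima of the two chains, and [p], [q] the maxima of their bottom
   segments. *)
Definition legal_merge C D E : bool :=
  [exists A in D, exists B in D, exists a, exists b, exists p, exists q,
    [&& A != B, is_minimum A a, is_minimum B b, color C a == color C b,
        is_maximum (bottom_segment C A a) p,
        is_maximum (bottom_segment C B b) q, p < q
      & E == move_segment D A B (bottom_segment C A a)]].

End ChainDecompositions.

Definition width {d : Order.disp_t} (T : finPOrderType d) : nat :=
  \max_(A : {set T} | is_antichain A) #|A|.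

(* Main.v *)
(** A legal merge joins two monochromatic runs of the decomposition and splits
    none, so every sequence of legal merges stops. When no merge is possible,
    the minima of the chains have distinct colors, so there are at most as many
    chains as colors, which is the minimum by hypothesis on [C]. That this
    minimum is the width is Dilworth's theorem, by Galvin's induction. *)
Require Import Defs.
From mathcomp Require Import all_boot all_order.

Set Implicit Arguments.
Unset Strict Implicit.
Unset Printing Implicit Defensive.

Import Order.TTheory.

Local Open Scope order_scope.

(** * Dilworth's theorem: colorings by chains and antichains of full size *)

Section Dilworth.

Context {d : Order.disp_t} {T : finPOrderType d}.
Implicit Types (x y z a : T) (A B X Y : {set T}) (D : {set {set T}}).

Lemma is_chainP A :
  reflect {in A &, forall x y, x >=< y} (is_chain A).
Proof.
apply: (iffP idP) => [/forall_inP cA x y xA yA | cA].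
  by move/forall_inP: (cA x xA); apply.
by apply/forall_inP => x xA; apply/forall_inP => y yA; apply: cA.
Qed.

Lemma is_antichainP A :
  reflect {in A &, forall x y, x >=< y -> x = y} (is_antichain A).
Proof.
apply: (iffP idP) => [/forall_inP cA x y xA yA xy | cA].
  apply/eqP; apply/negPn/negP => nxy.
  by move/forall_inP: (cA x xA) => /(_ y yA); rewrite nxy /= xy.
apply/forall_inP => x xA; apply/forall_inP => y yA; apply/implyP.
by apply: contra => /(cA x y xA yA) ->.
Qed.

Lemma is_chain_decompositionP D :
  reflect [/\ forall A, A \in D -> A != set0, forall A, A \in D -> is_chain A,
              forall x, exists2 A, A \in D & x \in A
            & forall A B x, A \in D -> B \in D -> x \in A -> x \in B -> A = B]
          (is_chain_decomposition D).
Proof.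
apply: (iffP andP) => [[/and3P[/eqP cD tD nD] /forall_inP chD]|[nD chD cD tD]].
  split=> // [A AD | x | A B x AD BD xA xB].
  - by apply: contraNneq nD => <-.
  - by apply/bigcupP; rewrite -/(cover D) cD inE.
  - by rewrite -(def_pblock tD AD xA) -(def_pblock tD BD xB).
split; last exact/forall_inP.
apply/and3P; split.
- apply/eqP/setP => x; rewrite inE; apply/bigcupP.
  by have [A AD xA] := cD x; exists A.
- apply/trivIsetP => A B AD BD; apply: contraNT => /pred0Pn[x /andP[xA xB]].
  exact/eqP/(tD A B x).
- by apply/negP => /nD; rewrite eqxx.
Qed.

(** Going strictly up enlarges the principal down-set, so an element of [A] whose down-set in [T]
    has the most elements is maximal in [A]. *)
Lemma exists_maximal A x :
  x \in A -> exists2 a, a \in A & {in A, forall z, a <= z -> z = a}.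
Proof.
move=> xA; pose h y := #|[set z | z <= y]|.
case: (@arg_maxnP _ x (mem A) h xA) => a aA amax; exists a => // z zA az.
have /eqP/setP/(_ z) : [set w | w <= a] == [set w | w <= z].
  rewrite eqEcard; apply/andP; split; last exact: amax.
  by apply/subsetP => w; rewrite !inE => wa; apply: le_trans az.
by rewrite !inE lexx => za; apply: le_anti; rewrite za.
Qed.

Lemma chain_maximum A x : is_chain A -> x \in A -> exists p, is_maximum A p.
Proof.
move=> /is_chainP cA /exists_maximal[p pA pmax]; exists p.
apply/andP; split=> //; apply/forall_inP => y yA.
by case/orP: (cA y p yA pA) => // /(pmax y yA) ->.
Qed.

(** Each color class is a chain, so [f] is injective on an antichain. An injection from [k] elements
    into [k] colors is onto, so an antichain of size [k] meets every color. *)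
Lemma antichain_hits_colors k (f : T -> nat) A Y i :
  {in A, forall x, (f x < k)%N} -> {in A &, forall x y, f x = f y -> x >=< y} ->
  Y \subset A -> is_antichain Y ->
  (#|Y| <= k)%N /\ (#|Y| = k -> (i < k)%N -> exists2 y, y \in Y & f y = i).
Proof.
move=> fk fch /subsetP YA /is_antichainP aY.
have u : uniq (map f (enum Y)).
  rewrite map_inj_in_uniq ?enum_uniq // => x y; rewrite !mem_enum => xY yY e.
  by apply: aY => //; apply: fch; rewrite ?YA.
have s : {subset map f (enum Y) <= iota 0 k}.
  move=> _ /mapP[y yY ->]; rewrite mem_iota /= add0n; apply: fk; apply: YA.
  by rewrite -mem_enum.
have sz : size (map f (enum Y)) = #|Y| by rewrite size_map -cardE.
split=> [|e ik]; first by rewrite -sz -[leqRHS](size_iota 0) uniq_leq_size.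
have [|_ ei] := uniq_min_size u s; first by rewrite sz e size_iota.
have : i \in iota 0 k by rewrite mem_iota.
by rewrite -ei => /mapP[y]; rewrite mem_enum => yY ->; exists y.
Qed.

(* Galvin's induction: remove a maximal element [a], and in each chain of the
   rest take the highest element lying on some antichain of full size. *)
Lemma dilworth_coloring A :
  exists f : T -> nat, exists2 X : {set T}, X \subset A & [/\ is_antichain X,
    {in A, forall x, (f x < #|X|)%N}
    & {in A &, forall x y, f x = f y -> x >=< y}].
Proof.
have [n] := ubnP #|A|; elim: n A => // n IH A ltAn.
have [->|[x0 x0A]] := set_0Vmem A.
  exists (fun=> 0%N), set0 => //; split; try by move=> x; rewrite inE.
  by apply/is_antichainP => x; rewrite inE.
have [a aA amax] := exists_maximal x0A.
pose A' := A :\ a.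
have A'A : A' \subset A by apply: subsetDl.
have [|f [X0 X0A' [aX0 fk fch]]] := IH A'.
  by rewrite (cardsD1 a A) aA in ltAn.
have hit := antichain_hits_colors _ fk fch.
set k := #|X0| in fk hit.
(* The elements on some antichain of full size [k] of [A']. Such an antichain has one element of
   each color. *)
pose full x := [exists Y : {set T}, [&& Y \subset A', is_antichain Y, #|Y| == k & x \in Y]].
have fullA' x : full x -> x \in A'.
  by move=> /existsP[Y /and4P[/subsetP YA _ _ /YA]].
(* [t i] is the highest full element of color [i]. One exists because [X0] meets color [i] and the
   full elements of that color form a chain. *)
have /fin_all_exists[t tP] (i : 'I_k) : exists x,
    [/\ full x, f x = i & forall y, full y -> f y = i -> y <= x].
  have [_ /(_ erefl (ltn_ord i))[y yX0 fy]] := hit X0 i X0A' aX0.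
  pose F := [set z | full z & f z == i].
  have yF : y \in F.
    rewrite inE fy eqxx andbT; apply/existsP; exists X0.
    by rewrite X0A' aX0 eqxx.
  have [|x] := @chain_maximum F y _ yF.
    apply/is_chainP => u v; rewrite !inE.
    move=> /andP[/fullA' uA /eqP fu] /andP[/fullA' vA /eqP fv].
    by apply: fch; rewrite // fu fv.
  rewrite /is_maximum inE => /andP[/andP[fx /eqP fxi] /forall_inP xm].
  exists x; split=> // z fz fzi; apply: xm.
  by rewrite inE fz fzi eqxx.
(* The [t i] form an antichain: a full antichain through [t j] has an element [y] of color [i], and
   [y <= t i <= t j] forces [y = t j], so the colors agree. *)
have lt_t i j : t i <= t j -> i = j.
  move=> tij; have [fi ei mi] := tP i; have [fj ej mj] := tP j.
  have /existsP[Y /and4P[YA' aY /eqP cY tjY]] := fj.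
  have [_ /(_ cY (ltn_ord i))[y yY fy]] := hit Y i YA' aY.
  have yti : y <= t i.
    apply: mi => //; apply/existsP; exists Y.
    by rewrite YA' aY cY eqxx.
  have e : y = t j.
    move/is_antichainP: aY; apply=> //.
    by rewrite /Order.comparable (le_trans yti tij).
  by apply: val_inj; rewrite /= -fy e.
have tinj : injective t by move=> i j e; apply: lt_t; rewrite e.
(* If [a] is above no [t i], it extends the antichain of the [t i] and receives the new color [k].
   This case comes first. Otherwise a chain through [a] can be removed. *)
have [/existsP[i tia]|/existsPn nta] := boolP [exists i, t i <= a]; last first.
  pose X := a |: [set t i | i : 'I_k].
  have tA' i : t i \in A' by have [/fullA'] := tP i.
  have ntX : a \notin [set t i | i : 'I_k].
    by apply/imsetP => -[i _ e]; move: (tA' i); rewrite -e !inE eqxx.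
  have cX : #|X| = k.+1 by rewrite cardsU1 ntX card_imset // card_ord.
  exists (fun x => if x == a then k else f x), X.
    rewrite subUset sub1set aA; apply/subsetP => _ /imsetP[i _ ->].
    by apply: (subsetP A'A).
  split.
  - have na i : ~~ (a >=< t i).
      rewrite /Order.comparable negb_or nta andbT; apply/negP => ati.
      have := tA' i; rewrite !inE => /andP[/eqP ne tiA].
      by apply: ne; apply: amax.
    apply/is_antichainP => x y /setU1P[->|/imsetP[i _ ->]] /setU1P[->|/imsetP[j _ ->]] //.
    + by rewrite (negbTE (na j)).
    + by rewrite comparable_sym (negbTE (na i)).
    + by move=> /orP[/lt_t ->|/lt_t ->].
  - move=> x xA; rewrite cX; case: eqVneq => // xa.
    by apply: ltnW; rewrite ltnS; apply: fk; rewrite !inE xa.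
  - move=> x y xA yA.
    case: (eqVneq x a) => [->|xa]; case: (eqVneq y a) => [->|ya] //.
    + by rewrite comparablexx.
    + by move=> e; have := fk y; rewrite -e !inE ya yA ltnn => /(_ isT).
    + by move=> e; have := fk x; rewrite e ltnn !inE xa xA => /(_ isT).
    + by apply: fch; rewrite !inE ?xa ?ya.
(* Removing this chain lowers the size of the largest antichain below [k]: a [k]-antichain avoiding
   [a] would have an element of color [i], which is full, hence at most [t i], hence in [K]. *)
pose K := a |: [set z in A' | (f z == i) && (z <= t i)].
have [|g [Y YAK [aY gk gch]]] := IH (A :\: K).
  apply: leq_trans (_ : (#|A'| < n)%N); last by rewrite (cardsD1 a A) aA in ltAn.
  by rewrite ltnS subset_leq_card // setDS // sub1set setU11.
have YA' : Y \subset A'.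
  by apply: subset_trans YAK _; rewrite setDS // sub1set setU11.
have [Yk hY] := hit Y i YA' aY.
have Yltk : (#|Y| < k)%N.
  rewrite ltn_neqAle Yk andbT; apply/negP => /eqP cY.
  have [y yY fy] := hY cY (ltn_ord i).
  have [_ _ mi] := tP i.
  have yti : y <= t i.
    apply: mi => //; apply/existsP; exists Y.
    by rewrite YA' aY cY eqxx.
  have := subsetP YAK y yY; rewrite inE => /andP[/negP[]].
  apply/setU1P; right.
  by rewrite inE (subsetP YA' _ yY) fy eqxx yti.
have Kch : is_chain K.
  apply/is_chainP => x y /setU1P[->|]; last rewrite inE.
    move=> /setU1P[->|]; first by rewrite comparablexx.
    rewrite inE => /and3P[_ _ yt].
    by rewrite /Order.comparable (le_trans yt tia) orbT.
  move=> /and3P[xA /eqP fx xt] /setU1P[->|].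
    by rewrite /Order.comparable (le_trans xt tia).
  by rewrite inE => /and3P[yA /eqP fy yt]; apply: fch; rewrite ?fx.
(* The coloring [g] of the rest uses only colors below [#|Y|], so [#|Y|] is free for [K]; since
   [#|Y| < k], all colors stay below [#|X0|]. *)
exists (fun x => if x \in K then #|Y| else g x), X0.
  exact: subset_trans A'A.
split=> // [x xA|x y xA yA].
  case: ifPn => // xK; apply: leq_trans (_ : (#|Y| <= k)%N) => //.
  by apply: gk; rewrite inE xK.
case: ifPn => xK; case: ifPn => yK.
- by move=> _; move/is_chainP: Kch; apply.
- by move=> e; have := gk y; rewrite -e ltnn inE yK yA => /(_ isT).
- by move=> e; have := gk x; rewrite e ltnn inE xK xA => /(_ isT).
- by apply: gch; rewrite inE ?xK ?yK.
Qed.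

(** A chain contains at most one element of an antichain, so sending each element to its chain is
    injective on an antichain. *)
Lemma width_le_card D : is_chain_decomposition D -> (width T <= #|D|)%N.
Proof.
move=> /is_chain_decompositionP[_ chD cD _].
apply/bigmax_leqP => X /is_antichainP aX.
have /fin_all_exists[b bP] (x : T) : exists A, (A \in D) && (x \in A).
  by have [A AD xA] := cD x; exists A; rewrite AD.
rewrite -(card_in_imset (f := b) (D := mem X)).
  by apply/subset_leq_card/subsetP => _ /imsetP[x _ ->]; have /andP[] := bP x.
move=> x y xX yX e; apply: aX => //.
have /andP[bD xb] := bP x; have /andP[_ yb] := bP y.
by have /is_chainP := chD _ bD; apply; rewrite // e.
Qed.

(** The nonempty color classes of [dilworth_coloring] are at most [#|X|] chains, and [#|X|] is at
    most the width. *)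
Lemma dilworth : exists2 D : {set {set T}},
  is_chain_decomposition D & #|D| = width T.
Proof.
have [f [X _ [aX fk fch]]] := dilworth_coloring setT.
pose P := [set [set x | f x == i] | i : 'I_#|X|] :\ set0.
have dP : is_chain_decomposition P.
  apply/is_chain_decompositionP; split.
  - by move=> A /setD1P[].
  - move=> _ /setD1P[_ /imsetP[i _ ->]]; apply/is_chainP => x y.
    by rewrite !inE => /eqP fx /eqP fy; apply: fch; rewrite ?inE ?fx.
  - move=> x; exists [set y | f y == f x]; last by rewrite inE.
    apply/setD1P; split; first by apply/set0Pn; exists x; rewrite inE.
    by apply/imsetP; exists (Ordinal (fk x (in_setT x))).
  - move=> _ _ x /setD1P[_ /imsetP[i _ ->]] /setD1P[_ /imsetP[j _ ->]].
    by rewrite !inE => /eqP <- /eqP <-.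
exists P => //; apply/eqP; rewrite eqn_leq width_le_card // andbT.
apply: leq_trans (leq_bigmax_cond _ aX).
apply: leq_trans (subset_leq_card (subsetDl _ _)) _.
by apply: leq_trans (leq_imset_card _ _) _; rewrite card_ord.
Qed.

Lemma card_minimal_decomposition D :
  is_minimal_decomposition D -> #|D| = width T.
Proof.
move=> [dD mD]; have [E dE cE] := dilworth.
by apply/eqP; rewrite eqn_leq width_le_card // -cE mD.
Qed.

End Dilworth.

(** * Legal merges for the coloring induced by [C] *)

Section LegalMerges.

Context {d : Order.disp_t} {T : finPOrderType d}.
Variable C : {set {set T}}.
Hypothesis dC : is_chain_decomposition C.
Implicit Types (x y z a b p q : T) (A B : {set T}) (D E : {set {set T}}).

Lemma color_comparable x y : color C x = color C y -> x >=< y.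
Proof.
have /andP[/and3P[/eqP cC _ _] _] := dC.
have /is_chain_decompositionP[_ chC _ _] := dC.
have inC z : z \in cover C by rewrite cC inE.
move=> e; have /is_chainP := chC _ (pblock_mem (inC x)); apply.
  by rewrite mem_pblock.
by rewrite -/(color C x) e mem_pblock.
Qed.

Lemma chain_minimum A x : is_chain A -> x \in A -> exists a, is_minimum A a.
Proof.
(* A minimum is a maximum for the dual order. *)
move=> /is_chainP cA; have dual_cA : @is_chain _ T^d A.
  by apply/is_chainP => y z yA zA; rewrite comparable_sym; apply: cA.
by case/(chain_maximum dual_cA) => a aP; exists a.
Qed.

(** The smallest initial segment of [A] containing [x] is the part of [A] below [x], so it suffices
    to test the color there. *)
Lemma bottom_segmentP A a x :
  reflect (x \in A /\ {in A, forall w, w <= x -> color C w = color C a})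
          (x \in bottom_segment C A a).
Proof.
apply: (iffP bigcupP).
  move=> [I /andP[/andP[/subsetP IA /forall_inP Iini] /forall_inP Icol] xI].
  split=> [|w wA wx]; first exact: IA.
  by apply/eqP/Icol; move/forall_inP: (Iini x xI) => /(_ w wA); rewrite wx.
move=> [xA xcol]; exists [set w in A | w <= x]; last by rewrite inE xA /=.
apply/andP; split; last first.
  by apply/forall_inP => w; rewrite inE => /andP[wA wx]; rewrite xcol.
apply/andP; split; first by apply/subsetP => w; rewrite inE => /andP[].
apply/forall_inP => w; rewrite inE => /andP[wA wx].
apply/forall_inP => v vA; apply/implyP => vw.
by rewrite inE vA (le_trans vw wx).
Qed.

(* The termination measure: the pairs [x <= y] lying in one monochromatic run. *)
Definition linked D : {set T * T} :=
  [set u | [exists A in D, [&& u.1 \in A, u.2 \in A, u.1 <= u.2 &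
     [forall z in A, (u.1 <= z <= u.2) ==> (color C z == color C u.1)]]]].

Lemma linkedP D x y :
  reflect (exists2 A, A \in D & [/\ x \in A, y \in A, x <= y &
             {in A, forall z, x <= z -> z <= y -> color C z = color C x}])
          ((x, y) \in linked D).
Proof.
rewrite inE; apply: (iffP exists_inP) => /= -[A AD].
  move=> /and4P[xA yA xy /forall_inP h]; exists A => //; split=> // z zA xz zy.
  by apply/eqP; have /implyP := h z zA; apply; rewrite xz.
move=> [xA yA xy h]; exists A; rewrite // xA yA xy /=.
by apply/forall_inP => z zA; apply/implyP => /andP[xz zy]; rewrite h.
Qed.

(** * The effect of a single merge *)

Section OneMerge.

Variables (D : {set {set T}}) (A B : {set T}) (a b p q : T).
Hypotheses (dD : is_chain_decomposition D) (AD : A \in D) (BD : B \in D).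
Hypotheses (nAB : A != B) (cab : color C a = color C b).
Hypotheses (pmax : is_maximum (bottom_segment C A a) p).
Hypotheses (qmax : is_maximum (bottom_segment C B b) q) (pq : p < q).

Let M := bottom_segment C A a.
Let N := bottom_segment C B b.
Let E := move_segment D A B M.

Let MA x : x \in M -> x \in A.
Proof. by case/bottom_segmentP. Qed.

Let Mcol x : x \in M -> color C x = color C a.
Proof. by move=> /bottom_segmentP[xA]; apply. Qed.

Let Mdown x y : x \in M -> y \in A -> y <= x -> y \in M.
Proof.
move=> /bottom_segmentP[xA xc] yA yx; apply/bottom_segmentP; split=> // w wA wy.
by apply: xc => //; apply: le_trans yx.
Qed.

Let Ndown x : x \in B -> x <= q -> x \in N.
Proof.
move=> xB xq; have /andP[/bottom_segmentP[qB qc] _] := qmax.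
apply/bottom_segmentP; split=> // w wB wx.
by apply: qc => //; apply: le_trans xq.
Qed.

Let Ncol x : x \in N -> color C x = color C a.
Proof. by rewrite cab => /bottom_segmentP[xA]; apply. Qed.

Let Mltq x : x \in M -> x < q.
Proof. by move=> xM; have /andP[_ /forall_inP/(_ x xM) xp] := pmax; apply: le_lt_trans pq. Qed.

Let pM : p \in M. Proof. by case/andP: pmax. Qed.
Let qN : q \in N. Proof. by case/andP: qmax. Qed.
Let qB : q \in B. Proof. by case/bottom_segmentP: qN. Qed.

(** An element of [B] below some [y] in [M] is below [q], hence lies in [N], and [M] and [N] have
    the same color. *)
Let merged_below_col x y :
  x \in B :|: M -> y \in M -> x <= y -> color C x = color C a.
Proof.
move=> /setUP[xB yM xy|xM _ _]; last exact: Mcol.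
by apply/Ncol/Ndown => //; apply: le_trans xy (ltW (Mltq yM)).
Qed.

Let Achain : is_chain A.
Proof. by have /is_chain_decompositionP[_ h _ _] := dD; apply: h. Qed.

Let Bchain : is_chain B.
Proof. by have /is_chain_decompositionP[_ h _ _] := dD; apply: h. Qed.

Let mergedP F :
  reflect (F != set0 /\
           [\/ [/\ F \in D, F != A & F != B], F = A :\: M | F = B :|: M])
          (F \in E).
Proof.
apply: (iffP setD1P) => -[F0 h]; split=> //.
  case/setUP: h => [/setDP[FD]|/set2P[->|->]].
  - by rewrite !inE negb_or => /andP[]; constructor 1.
  - by constructor 2.
  - by constructor 3.
apply/setUP; case: h => [[FD FA FB]|->|->].
- by left; rewrite inE FD !inE negb_or FA FB.
- by right; rewrite !inE eqxx.
- by right; rewrite !inE eqxx orbT.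
Qed.

Let mergedE : B :|: M \in E.
Proof.
by apply/mergedP; split; [apply/set0Pn; exists q; rewrite inE qB | constructor 3].
Qed.

Let remainderE x : x \in A :\: M -> A :\: M \in E.
Proof. by move=> xF; apply/mergedP; split; [apply/set0Pn; exists x | constructor 2]. Qed.

Let otherE F : F \in D -> F != A -> F != B -> F \in E.
Proof.
have /is_chain_decompositionP[h _ _ _] := dD.
by move=> FD FA FB; apply/mergedP; split; [apply: h | constructor 1].
Qed.

(** The point is that [B :|: M] is a chain. An element of [B] below [q] lies in [N] and shares the
    color of [M]; an element above [q] is above all of [M]. *)
Lemma merge_decomposition : is_chain_decomposition E.
Proof.
have /is_chain_decompositionP[D0 chD cD tD] := dD.
apply/is_chain_decompositionP; split.
- by move=> F /mergedP[].
- move=> F /mergedP[_ [[FD _ _]|->|->]]; first exact: chD.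
    apply/is_chainP => x y /setDP[xA _] /setDP[yA _].
    by move/is_chainP: Achain; apply.
  have BM x y : x \in B -> y \in M -> x >=< y.
    move=> xB yM; move/is_chainP: Bchain => /(_ x q xB qB) /orP[xq|qx].
      by apply: color_comparable; rewrite (Mcol yM) Ncol // Ndown.
    by rewrite /Order.comparable (le_trans (ltW (Mltq yM)) qx) orbT.
  apply/is_chainP => x y /setUP[xB|xM] /setUP[yB|yM].
  + by move/is_chainP: Bchain; apply.
  + exact: BM.
  + by rewrite comparable_sym BM.
  + by move/is_chainP: Achain; apply; apply: MA.
- move=> x; have [F FD xF] := cD x.
  have [eA|FA] := eqVneq F A.
    have [xM|xM] := boolP (x \in M).
      by exists (B :|: M); rewrite // inE xM orbT.
    have xAM : x \in A :\: M by rewrite inE xM -eA.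
    by exists (A :\: M) => //; apply: remainderE xAM.
  have [eB|FB] := eqVneq F B; last by exists F => //; apply: otherE.
  by exists (B :|: M) => //; rewrite inE -eB xF.
- have offAB F x : F \in D -> F != A -> F != B -> x \in F -> (x \notin A) && (x \notin B).
    by move=> FD FA FB xF; apply/andP; split; [apply: contra FA | apply: contra FB];
       move=> xG; apply/eqP; apply: tD xF xG.
  have disj x : x \in A -> x \in B -> False.
    by move=> xA xB; move/eqP: nAB; apply; apply: tD xA xB.
  have offM F x : F \in D -> F != A -> F != B -> x \in F -> x \notin B :|: M.
    move=> FD FA FB xF; have /andP[xA xB] := offAB F x FD FA FB xF.
    by rewrite inE negb_or xB; apply: contra xA; apply: MA.
  have remM x : x \in A :\: M -> x \notin B :|: M.
    move=> /setDP[xA xM]; rewrite inE negb_or xM andbT.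
    by apply/negP; apply: disj.
  move=> F G x /mergedP[_ [[FD FA FB]|->|->]] /mergedP[_ [[GD GA GB]|->|->]] xF xG //.
  + exact: tD xF xG.
  + by have /andP[/negP[]] := offAB F x FD FA FB xF; case/setDP: xG.
  + by have /negP[] := offM F x FD FA FB xF.
  + by have /andP[/negP[]] := offAB G x GD GA GB xG; case/setDP: xF.
  + by have /negP[] := remM x xF.
  + by have /negP[] := offM G x GD GA GB xG.
  + by have /negP[] := remM x xG.
Qed.

(** No monochromatic run is broken, and the runs [M] and [N], previously in different chains, become
    linked. *)
Lemma merge_linked : linked D \proper linked E.
Proof.
have /is_chain_decompositionP[D0 chD cD tD] := dD.
apply/properP; split; last first.
  (* The tops of the two bottom segments form a new linked pair: in [D] they lie in the distinct
     chains [A] and [B]. *)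
  exists (p, q).
    apply/linkedP; exists (B :|: M) => //.
    split; [by rewrite inE pM orbT | by rewrite inE qB | exact: ltW |].
    move=> z /setUP[zB|zM] _ zq; rewrite (Mcol pM); last exact: Mcol.
    by apply/Ncol/Ndown.
  apply/negP => /linkedP[F FD [pF qF _ _]].
  have eA : F = A by apply: tD pF (MA pM).
  have eB : F = B by apply: tD qF qB.
  by move/eqP: nAB; rewrite -eA -eB.
apply/subsetP => -[x y] /linkedP[F FD [xF yF xy h]]; apply/linkedP.
have [eA|FA] := eqVneq F A.
  subst F; have [yM|yM] := boolP (y \in M).
    have xM : x \in M by apply: Mdown xy.
    exists (B :|: M) => //; split; rewrite ?inE ?xM ?yM ?orbT // => z zBM _ zy.
    by rewrite (Mcol xM); apply: merged_below_col zy.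
  (* The cut does not separate [x] from [y]: if [x] were in [M], every element of [A] below [y]
     would be below [x] or between [x] and [y], hence of the color of [a], and [y] would be in [M]
     too. *)
  have xM : x \notin M.
    apply: contra yM => /[dup] xM /bottom_segmentP[_ xc].
    apply/bottom_segmentP; split=> // w wA wy.
    move/is_chainP: Achain => /(_ w x wA xF) /orP[wx|xw]; first exact: xc.
    by rewrite h // Mcol.
  have xAM : x \in A :\: M by rewrite inE xM.
  exists (A :\: M); first exact: remainderE xAM.
  by split; rewrite // ?inE ?yM // => z /setDP[zA _]; apply: h.
have [eB|FB] := eqVneq F B; last by exists F => //; apply: otherE.
subst F; exists (B :|: M) => //; split; rewrite ?inE ?xF ?yF // => z /setUP[zB|zM] xz zy.
  exact: h.
(* An element [z] of [M] inserted between [x] and [y] does not break their run, since [x] in [B]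
   below [z] already has the color of [M]. *)
by rewrite (Mcol zM); apply/esym; apply: merged_below_col zM xz; rewrite inE xF.
Qed.

End OneMerge.

(** When no merge is legal, sending a chain to the color of its minimum is an injection from [D]
    into [C]. *)
Lemma no_merge_card D : is_chain_decomposition D ->
  (forall E, ~~ legal_merge C D E) -> (#|D| <= #|C|)%N.
Proof.
move=> /is_chain_decompositionP[D0 chD _ tD] stuck.
have /andP[/and3P[/eqP cC _ _] _] := dC.
(* The default [set0] is never reached on [D], whose chains are nonempty and so have minima. *)
pose mcol A := oapp (color C) set0 [pick a | is_minimum A a].
have mcolP A : A \in D -> exists2 a, is_minimum A a & mcol A = color C a.
  move=> AD; rewrite /mcol; case: pickP => [a am|no]; first by exists a.
  have /set0Pn[x xA] := D0 A AD.
  by have [a] := chain_minimum (chD A AD) xA; rewrite no.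
have bottom_max A a : A \in D -> is_minimum A a ->
    exists p, is_maximum (bottom_segment C A a) p.
  move=> AD /andP[aA /forall_inP amin]; apply: (@chain_maximum _ _ _ a).
    apply/is_chainP => x y /bottom_segmentP[xA _] /bottom_segmentP[yA _].
    by have /is_chainP := chD A AD; apply.
  apply/bottom_segmentP; split=> // w wA wa.
  by congr color; apply: le_anti; rewrite wa amin.
rewrite -(card_in_imset (f := mcol) (D := mem D)).
  apply/subset_leq_card/subsetP => _ /imsetP[A /mcolP[a _ ->] ->].
  by apply: pblock_mem; rewrite cC inE.
move=> A B AD BD eAB; apply/eqP; apply/negPn/negP => nAB.
have [a am ea] := mcolP A AD; have [b bm eb] := mcolP B BD.
have cab : color C a = color C b by rewrite -ea -eb.
have [p pm] := bottom_max A a AD am; have [q qm] := bottom_max B b BD bm.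
have merge A1 B1 a1 b1 p1 q1 : A1 \in D -> B1 \in D -> A1 != B1 ->
    is_minimum A1 a1 -> is_minimum B1 b1 -> color C a1 = color C b1 ->
    is_maximum (bottom_segment C A1 a1) p1 ->
    is_maximum (bottom_segment C B1 b1) q1 -> ~~ (p1 < q1).
  move=> A1D B1D n1 am1 bm1 c1 pm1 qm1; apply/negP => pq.
  have /negP[] := stuck (move_segment D A1 B1 (bottom_segment C A1 a1)).
  apply/exists_inP; exists A1 => //; apply/exists_inP; exists B1 => //.
  apply/existsP; exists a1; apply/existsP; exists b1.
  apply/existsP; exists p1; apply/existsP; exists q1.
  by rewrite n1 am1 bm1 c1 pm1 qm1 pq !eqxx.
have /andP[/bottom_segmentP[pA pc] _] := pm.
have /andP[/bottom_segmentP[qB qc] _] := qm.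
have npq : p != q.
  by apply: contra nAB => /eqP e; apply/eqP/(tD _ _ p); rewrite // e.
(* The tops [p] and [q] share a color, so they are comparable; being distinct, they allow a merge in
   one of the two directions. *)
have cpq : p >=< q by apply: color_comparable; rewrite (pc p) ?(qc q).
have := merge A B a b p q AD BD nAB am bm cab pm qm.
have := merge B A b a q p BD AD _ bm am (esym cab) qm pm.
rewrite eq_sym => /(_ nAB); rewrite !lt_neqAle npq eq_sym npq /=.
by case/orP: cpq => ->.
Qed.

(** Each merge strictly enlarges [linked D] inside the finite set of all pairs, so merging stops; a
    stuck decomposition has at most [#|C|] chains, and [C] is minimal. *)
Lemma merge_to_minimal D : is_minimal_decomposition C ->
  is_chain_decomposition D ->
  exists2 E, connect (legal_merge C) D E & is_minimal_decomposition E.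
Proof.
move=> [_ minC].
have [n] := ubnP (#|{: T * T}| - #|linked D|)%N; elim: n D => // n IH D ltn dD.
have [/existsP[E mE]|/existsPn stuck] := boolP [exists E, legal_merge C D E].
  have /exists_inP[A AD /exists_inP[B BD]] := mE.
  move=> /existsP[a /existsP[b /existsP[p /existsP[q]]]].
  move=> /and5P[nAB _ _ /eqP cab /and4P[pm qm pq /eqP eE]].
  have dE : is_chain_decomposition E.
    by rewrite eE; apply: merge_decomposition cab pm qm pq.
  have /proper_card lt : linked D \proper linked E.
    by rewrite eE; apply: merge_linked cab pm qm pq.
  have [|F EF mF] := IH E _ dE; last first.
    by exists F => //; apply: connect_trans EF; apply: connect1.
  rewrite -ltnS; apply: leq_trans ltn; rewrite ltnS ltn_sub2l //.
  exact: leq_trans lt (max_card _).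
exists D => //; split=> // F dF.
exact: leq_trans (no_merge_card dD stuck) (minC F dF).
Qed.

End LegalMerges.

Theorem mainTheorem2 (d : Order.disp_t) (T : finPOrderType d) (k : nat)
    (C : {set {set T}}) (hC : is_minimal_decomposition C) (hk : #|C| = k)
    (D : {set {set T}}) (hD : is_chain_decomposition D) :
  exists E : {set {set T}},
    [/\ connect (legal_merge C) D E,
        is_minimal_decomposition E
      & #|E| = width T].
Proof.
have [E DE mE] := merge_to_minimal (proj1 hC) hC hD.
by exists E; split; rewrite ?card_minimal_decomposition.
Qed.
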